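(* Let $p$ be an odd prime, let $q\in\mathbb{C}_p$ with $|q-1|_p<1$ and $q$ not a root of unity, let $\alpha$ be a positive integer, let $\chi$ be a Dirichlet character with odd conductor $d$, $(d,p)=1$, and let $n\ge 0$ be an integer. Then for every $x\in\mathbb{Z}_p$, $$\widetilde{\mathcal{E}}_{n,q}^{\chi}(dx\mid\alpha)=\frac{[d:q^{\alpha}]^{n}}{[d:-q]}\sum_{a=0}^{d-1}(-1)^{a}\chi(a)\,q^{a}\,\widetilde{E}_{n,q^{d}}\!\left(x+\frac{a}{d}\,\Big|\,\alpha\right).$$
   Context: $\mathbb{C}_p$ is the completion of an algebraic closure of $\mathbb{Q}_p$; values of $\chi$ are viewed in $\mathbb{C}_p$ via a fixed embedding. For $Q\ne1$, $[y:Q]=\frac{Q^{y}-1}{Q-1}$ (with $Q^y$ the continuous extension to $y\in\mathbb{Z}_p$ when $|Q-1|_p<1$); in particular $[N:-Q]=\frac{1-(-Q)^N}{1+Q}$ for integers $N\geq 0$. For $x\in\mathbb{Z}_p$ the Dirichlet type $q$-Euler polynomials with weight $\alpha$ are defined by the fermionic $p$-adic $q$-integral $$\widetilde{\mathcal{E}}_{n,q}^{\chi}(x\mid\alpha)=\int\chi(\eta)[x+\eta:q^{\alpha}]^{n}\,d\mu_{-q}(\eta):=\lim_{N\to\infty}\frac{1}{[dp^{N}:-q]}\sum_{y=0}^{dp^{N}-1}(-q)^{y}\chi(y)[x+y:q^{\alpha}]^{n}.$$ The $q$-Euler polynomials with weight $\alpha$ are, for base $Q$ with $|Q-1|_p<1$,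 $Q$ not a root of unity, and $x\in\mathbb{Z}_p$, $$\widetilde{E}_{n,Q}(x\mid\alpha)=\lim_{N\to\infty}\frac{1}{[p^{N}:-Q]}\sum_{y=0}^{p^{N}-1}(-Q)^{y}[x+y:Q^{\alpha}]^{n}.$$ *)

(* Defs.v *)
From HB Require Import structures.
From mathcomp Require Import all_boot all_order all_algebra all_field.
From mathcomp Require Import all_classical all_reals all_analysis.

Set Implicit Arguments.
Unset Strict Implicit.
Unset Printing Implicit Defensive.

Import Order.TTheory GRing.Theory Num.Theory.

Local Open Scope classical_set_scope.
Local Open Scope ring_scope.

(* MathComp's normedZmodType does not apply here: its axiom |x *+ n| = |x| *+ n
   only holds for archimedean norms. *)
Record ultrametric_abs (R : realType) (K : fieldType) := UltrametricAbs {
  vabs :> K -> R;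
  vabs_ge0 : forall x, 0 <= vabs x;
  vabs_eq0 : forall x, (vabs x == 0) = (x == 0);
  vabsM : forall x y, vabs (x * y) = vabs x * vabs y;
  vabs_ultra : forall x y, vabs (x + y) <= Num.max (vabs x) (vabs y)
}.

(* The field K with the metric v (x - y) *)
Definition valued (R : realType) (K : fieldType) (v : ultrametric_abs R K) :
  Type := K.

HB.instance Definition _ (R : realType) (K : fieldType)
  (v : ultrametric_abs R K) := GRing.Field.copy (valued v) K.

Section ValuedMetric.
Variables (R : realType) (K : fieldType) (v : ultrametric_abs R K).

Definition vdist (x y : K) : R := v (x - y).

Lemma vabs0 : v 0 = 0.
Proof. by apply/eqP; rewrite vabs_eq0. Qed.

Lemma vabs1 : v 1 = 1.
Proof.
have v1 : v 1 != 0 by rewrite vabs_eq0 oner_eq0.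
by apply: (mulfI v1); rewrite -vabsM !mulr1.
Qed.

Lemma vabsN x : v (- x) = v x.
Proof.
suff vN1 : v (- 1) = 1 by rewrite -mulN1r vabsM vN1 mul1r.
have /eqP : v (- 1) ^+ 2 = 1 by rewrite expr2 -vabsM mulrNN mulr1 vabs1.
rewrite sqrf_eq1 => /orP[/eqP//|/eqP vN1].
by have := vabs_ge0 v (- 1); rewrite vN1 ler0N1.
Qed.

Lemma vdistxx x : vdist x x = 0.
Proof. by rewrite /vdist subrr vabs0. Qed.

Lemma vdist_positivity x y : vdist x y = 0 -> x = y.
Proof. by move/eqP; rewrite vabs_eq0 subr_eq0 => /eqP. Qed.

Lemma vdist_sym x y : vdist x y = vdist y x.
Proof. by rewrite /vdist -vabsN opprB. Qed.

Lemma vdist_triangle y x z : vdist x z <= vdist x y + vdist y z.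
Proof.
rewrite /vdist -(subrKA y); apply: le_trans (vabs_ultra _ _ _) _.
by rewrite ge_max lerDl lerDr !vabs_ge0.
Qed.

HB.instance Definition _ := @isMetric.Build R (valued v)
  vdist vdistxx vdist_positivity vdist_sym vdist_triangle.

HB.instance Definition _ := isPointed.Build (valued v) 0.

End ValuedMetric.

Section PadicFields.
Variables (R : realType) (p : nat) (K : fieldType) (v : ultrametric_abs R K).
Local Notation Kv := (valued v).

(* In a complete field whose absolute value extends the p-adic one of the
   rationals, the closure of the rationals is their p-adic completion. *)
Definition padic_num : set Kv := closure (range (ratr : rat -> Kv)).

Definition padic_int : set Kv := [set x | padic_num x /\ v x <= 1].

Definition padic_alg : set Kv :=
  [set x | exists P : {poly Kv}, [/\ P != 0, forall i, padic_num P`_i & root P x]].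

(* K is the completion of an algebraic closure of Q_p; this determines K up to
   isometric isomorphism. [Cp_vabsp] forces v to be, on the rationals, the
   p-adic absolute value normalized by |p| = 1/p. *)
Record is_Cp : Prop := IsCp {
  Cp_vabsp : v p%:R = p%:R^-1;
  Cp_complete : forall F : set_system Kv, ProperFilter F -> cauchy F -> cvg F;
  Cp_closed : forall P : {poly Kv}, (forall i, padic_alg P`_i) ->
    (1 < size P)%N -> exists2 x, padic_alg x & root P x;
  Cp_dense : dense padic_alg
}.

(* The function y |-> Q ^ y on Z_p, for |Q - 1| < 1: the extension by
   continuity of m |-> Q ^+ m. It is uniquely determined on Z_p because the
   natural numbers are dense there; its values outside Z_p are irrelevant. *)
Definition padic_exp (Q : Kv) : Kv -> Kv :=
  xget (fun=> 0) [set f : Kv -> Kv |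
    {within padic_int, continuous f} /\ forall m : nat, f m%:R = Q ^+ m].

(* [m : Q] for a natural number m, any Q <> 1: Q = - q is not near 1 *)
Definition qnum (m : nat) (Q : Kv) : Kv := (Q ^+ m - 1) / (Q - 1).

(* [y : Q] for y in Z_p and |Q - 1| < 1, Q <> 1 *)
Definition padic_qnum (y Q : Kv) : Kv := (padic_exp Q y - 1) / (Q - 1).

Definition euler_poly (alpha n : nat) (Q x : Kv) : Kv :=
  lim ((qnum (p ^ N) (- Q))^-1 *
       \sum_(0 <= y < p ^ N)
         (- Q) ^+ y * padic_qnum (x + y%:R) (Q ^+ alpha) ^+ n @[N --> \oo]).

Definition dirichlet_euler_poly (d : nat) (chi : int -> Kv)
    (alpha n : nat) (q x : Kv) : Kv :=
  lim ((qnum (d * p ^ N) (- q))^-1 *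
       \sum_(0 <= y < d * p ^ N)
         (- q) ^+ y * chi y%:Z * padic_qnum (x + y%:R) (q ^+ alpha) ^+ n
       @[N --> \oo]).

End PadicFields.

Record dirichlet_character (d : nat) (chi : int -> algC) : Prop :=
  DirichletCharacter {
  dirichlet_periodic : forall a b : int, (a = b %[mod d])%Z -> chi a = chi b;
  dirichlet_mul : forall a b : int, chi (a * b) = chi a * chi b;
  dirichlet_one : chi 1 = 1;
  dirichlet_eq0 : forall a : int, (chi a == 0) = ~~ coprimez a d
}.

(* f is an induced modulus of the character chi modulo d when chi is trivial on
   the classes prime to d that are congruent to 1 modulo f. *)
Definition induced_modulus (d : nat) (chi : int -> algC) (f : nat) : Prop :=
  (f %| d)%N /\
  forall a : int, coprimez a d -> (a = 1 %[mod f])%Z -> chi a = 1.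

(* A character of conductor d is taken as a (primitive) character modulo d. *)
Definition dirichlet_character_of_conductor (d : nat) (chi : int -> algC) :=
  [/\ (0 < d)%N, dirichlet_character d chi
    & forall f : nat, induced_modulus d chi f -> (d <= f)%N].

(* Main.v *)
Require Import Defs.
From HB Require Import structures.
From mathcomp Require Import all_boot all_order all_algebra all_field.
From mathcomp Require Import all_classical all_reals all_analysis.
From mathcomp Require Import ring.

Set Implicit Arguments.
Unset Strict Implicit.
Unset Printing Implicit Defensive.

Import Order.TTheory GRing.Theory Num.Theory.

Local Open Scope classical_set_scope.
Local Open Scope ring_scope.

(** Both sides are limits of finite averages, and the identity already holds
    for the averages. Write y < d p ^ N as y = a + d z with a < d and
    z < p ^ N. Then chi y = chi a; since d is odd,
    (- q) ^ y = (- q) ^ a * (- q ^ d) ^ z; and d x + y = d (x + a / d + z), so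
    that [d x + y : q ^ alpha] is [d : q ^ alpha] times
    [x + a / d + z : q ^ (d alpha)]. The normalizing factor splits in the same
    way: [d p ^ N : - q] = [d : - q] [p ^ N : - q ^ d]. This is
    [dirichlet_euler_sum_distribution].

    To pass to the limit, each of the d averages on the right must converge
    ([euler_poly_cvg]). The binomial formula turns
    [x + y : Q ^ alpha] ^ n into a combination of powers (Q ^ j) ^ y, because
    Q ^ (x + y) = Q ^ x Q ^ y. The average of such a power is a quotient of two
    geometric sums, equal to
      (1 + Q) / (1 + Q ^ (j + 1))
        * (1 + Q ^ ((j + 1) p ^ N)) / (1 + Q ^ (p ^ N)),
    and the second factor tends to 1, as Q ^ (p ^ N) tends to 1 and
    1 + Q ^ m is a unit for p odd ([fermionic_exp_cvg]).

    The laws of exponents for p-adic integer exponents are obtained from those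
    for natural numbers by continuity. The map m |-> Q ^ m is uniformly
    continuous for the p-adic distance because Q ^ (p ^ N) tends to 1
    ([exp_unif_continuous]), and the natural numbers are dense in the p-adic
    integers ([padic_intP]). By completeness the map extends, so that
    [padic_exp] does satisfy the condition which defines it, and its value at x
    is the limit of Q ^ m when m tends to x ([padic_expP]). *)

(** * Ultrametric absolute values and limits *)

Lemma expr_lt_eps (R : realType) (r e : R) :
  0 <= r < 1 -> 0 < e -> exists N, r ^+ N < e.
Proof.
move=> /andP[r0 r1] e0.
have /cvgrPdist_lt/(_ e e0)[N _ /(_ N (leqnn N))] : r ^+ n @[n --> \oo] --> 0.
  by apply: cvg_expr; rewrite ger0_norm.
by rewrite sub0r normrN ger0_norm ?exprn_ge0//; exists N.
Qed.

Section Ultrametric.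
Variables (R : realType) (K : fieldType) (v : ultrametric_abs R K).
Local Notation Kv := (valued v).
Implicit Types (x y z Q : Kv) (r e : R).

Lemma vabs_mul x y : v (x * y) = v x * v y.
Proof. exact: vabsM. Qed.

Lemma vabs_opp x : v (- x) = v x.
Proof. exact: vabsN. Qed.

Lemma vabs_sub x y : v (x - y) = v (y - x).
Proof. by rewrite -vabs_opp opprB. Qed.

Lemma vabs_one : v (1 : Kv) = 1.
Proof. exact: vabs1. Qed.

Lemma vabs_zero : v (0 : Kv) = 0.
Proof. exact: vabs0. Qed.

Lemma vabs_is0 x : (v x == 0) = (x == 0).
Proof. exact: vabs_eq0. Qed.

Lemma vabs_gt0 x : (0 < v x) = (x != 0).
Proof. by rewrite lt_neqAle vabs_ge0 andbT eq_sym vabs_is0. Qed.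

Lemma vabs_exp x n : v (x ^+ n) = v x ^+ n.
Proof. by elim: n => [|n IH]; rewrite ?expr0 ?vabs_one// !exprS vabs_mul IH. Qed.

Lemma vabs_inv x : v x^-1 = (v x)^-1.
Proof.
have [->|x0] := eqVneq x 0; first by rewrite invr0 vabs_zero invr0.
have vx0 : v x != 0 by rewrite vabs_is0.
by apply: (mulfI vx0); rewrite -vabs_mul !divff// vabs_one.
Qed.

Lemma vabsD_le x y r : v x <= r -> v y <= r -> v (x + y) <= r.
Proof.
by move=> xr yr; apply: le_trans (vabs_ultra _ _ _) _; rewrite ge_max xr.
Qed.

Lemma vabsD_lt x y r : v x < r -> v y < r -> v (x + y) < r.
Proof.
by move=> xr yr; apply: le_lt_trans (vabs_ultra _ _ _) _; rewrite gt_max xr.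
Qed.

Lemma vabsB_lt x y r : v x < r -> v y < r -> v (x - y) < r.
Proof. by move=> xr yr; apply: vabsD_lt; rewrite ?vabs_opp. Qed.

Lemma vabs_trans z x y r : v (x - z) < r -> v (z - y) < r -> v (x - y) < r.
Proof. by move=> xz zy; rewrite -(subrKA z); apply: vabsD_lt. Qed.

Lemma vabs_sum_le (I : Type) (s : seq I) (P : pred I) (F : I -> Kv) r :
  0 <= r -> (forall i, P i -> v (F i) <= r) -> v (\sum_(i <- s | P i) F i) <= r.
Proof.
move=> r0 Fr; elim/big_ind: _ => //; first by rewrite vabs_zero.
by move=> x y; apply: vabsD_le.
Qed.

Lemma vabs_nat_le1 n : v (n%:R : Kv) <= 1.
Proof.
elim: n => [|n IH]; first by rewrite vabs_zero.
by rewrite -natr1; apply: vabsD_le; rewrite // vabs_one.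
Qed.

(** In a triangle of vertices 0, x, y the two longest sides are equal. *)
Lemma vabs_eq_near x y : v (x - y) < v y -> v x = v y.
Proof.
move=> xy; apply: le_anti; apply/andP; split.
  by rewrite -(subrK y x); apply: vabsD_le; rewrite // ltW.
rewrite leNgt; apply/negP => lt_xy.
have : v (x - (x - y)) < v y by apply: vabsB_lt.
by rewrite opprB addrCA subrr addr0 ltxx.
Qed.

Lemma vabs_unit x : v (x - 1) < 1 -> v x = 1.
Proof. by move=> x1; rewrite -vabs_one; apply: vabs_eq_near; rewrite vabs_one. Qed.

Lemma vabs_unit_exp Q n : v (Q - 1) < 1 -> v (Q ^+ n) = 1.
Proof. by move=> Q1; rewrite vabs_exp vabs_unit// expr1n. Qed.

Lemma vabs_exp_sub1 Q n : v (Q - 1) < 1 -> v (Q ^+ n - 1) <= v (Q - 1).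
Proof.
move=> Q1; rewrite subrX1 vabs_mul ler_piMr ?vabs_ge0//.
apply: vabs_sum_le => // i _.
by rewrite vabs_unit_exp.
Qed.

Lemma vabs_exp_near1 Q n : v (Q - 1) < 1 -> v (Q ^+ n - 1) < 1.
Proof. by move=> Q1; apply: le_lt_trans (vabs_exp_sub1 n Q1) Q1. Qed.

Lemma vballE x e : ball x e = [set y : Kv | v (x - y) < e].
Proof. by rewrite ballEmdist. Qed.

Lemma cvg_vabsP (T : Type) (F : set_system T) {FF : Filter F} (u : T -> Kv) l :
  u t @[t --> F] --> l <->
  forall e, 0 < e -> \forall t \near F, v (l - u t) < e.
Proof. by split=> [/cvg_ballP|] h; [|apply/cvg_ballP] => e /h; rewrite vballE. Qed.

Lemma cvg_vabs_lim (T : Type) (F : set_system T) {FF : ProperFilter F}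
  (u : T -> Kv) l : u t @[t --> F] --> l -> lim (u t @[t --> F]) = l.
Proof. by apply: cvg_lim; exact: metric_hausdorff. Qed.

Lemma cvg_vabs_sum (T I : Type) (F : set_system T) {FF : Filter F} (s : seq I)
    (c l : I -> Kv) (u : I -> T -> Kv) :
  (forall i, u i t @[t --> F] --> l i) ->
  \sum_(i <- s) c i * u i t @[t --> F] --> \sum_(i <- s) c i * l i.
Proof.
move=> ul; apply/cvg_vabsP => e e0.
elim: s => [|i s IH].
  by apply: nearW => t; rewrite !big_nil subr0 vabs_zero.
have ci0 : 0 < v (c i) + 1 by rewrite ltr_wpDl// vabs_ge0.
have /cvg_vabsP/(_ (e / (v (c i) + 1)))/(_ (divr_gt0 e0 ci0)) := ul i.
apply: filterS2 IH => t IH ut; rewrite !big_cons opprD addrACA -mulrBr.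
apply: vabsD_lt => //; rewrite vabs_mul.
apply: (@le_lt_trans _ _ ((v (c i) + 1) * v (l i - u i t))).
  by rewrite ler_wpM2r ?vabs_ge0// lerDl.
by rewrite mulrC -ltr_pdivlMr.
Qed.

End Ultrametric.

(** * Natural numbers and p-adic integers *)

Section PadicIntegers.
Variables (R : realType) (p : nat) (K : fieldType) (v : ultrametric_abs R K).
Hypotheses (p_prime : prime p) (vp : v p%:R = p%:R^-1).
Local Notation Kv := (valued v).
Implicit Types (x y z Q w : Kv) (e : R).

Lemma coprime_prime_gt0 m : coprime m p -> (0 < m)%N.
Proof. by case: m => //; rewrite /coprime gcd0n gtn_eqF// prime_gt1. Qed.

Lemma vabs_p : v (p%:R : Kv) = p%:R^-1.
Proof. exact: vp. Qed.

Lemma vabs_p_gt0 : 0 < v (p%:R : Kv).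
Proof. by rewrite vabs_p invr_gt0 ltr0n prime_gt0. Qed.

Lemma vabs_p_lt1 : v (p%:R : Kv) < 1.
Proof. by rewrite vabs_p invf_lt1 ?ltr1n ?ltr0n ?prime_gt1// prime_gt0. Qed.

Lemma vabs_dvdn m n : (m %| n)%N -> v (n%:R : Kv) <= v (m%:R : Kv).
Proof.
case/dvdnP=> k ->; rewrite natrM vabs_mul ler_piMl ?vabs_ge0//.
exact: vabs_nat_le1.
Qed.

(** Bezout: 1 is a combination of m and p with integer coefficients, so m
    cannot be as small as p. *)
Lemma vabs_coprime m : coprime m p -> v (m%:R : Kv) = 1.
Proof.
move=> mp; have m0 := coprime_prime_gt0 mp.
case: (egcdnP p m0) => a b abE _; move: abE; rewrite (eqP mp) => abE.
have aE : (a * m)%:R - 1 = (b * p)%:R :> Kv by rewrite abE natrD addrK.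
have am1 : v ((a * m)%:R : Kv) = 1.
  apply: vabs_unit; rewrite aE; apply: le_lt_trans vabs_p_lt1.
  by apply: vabs_dvdn; rewrite dvdn_mull.
apply: le_anti; rewrite vabs_nat_le1/= -am1 natrM vabs_mul.
by rewrite ler_piMl ?vabs_ge0// vabs_nat_le1.
Qed.

Lemma vabs_nat n : (0 < n)%N -> v (n%:R : Kv) = v (p%:R : Kv) ^+ logn p n.
Proof.
move=> n0; case: (pfactor_coprime p_prime n0) => m pm {1}->.
by rewrite natrM natrX vabs_mul vabs_exp vabs_coprime ?mul1r// coprime_sym.
Qed.

Lemma padic_natr_neq0 n : (0 < n)%N -> (n%:R : Kv) != 0.
Proof. by move=> n0; rewrite -vabs_gt0 vabs_nat// exprn_gt0// vabs_p_gt0. Qed.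

Lemma vabs_dvdn_pfactor N n :
  v (n%:R : Kv) <= v (p%:R : Kv) ^+ N -> (p ^ N %| n)%N.
Proof.
have [->|n0] := posnP n; first by rewrite dvdn0.
rewrite vabs_nat// pfactor_dvdn// ler_iXn2l//; last exact: vabs_p_lt1.
exact: vabs_p_gt0.
Qed.

(** By Bezout, k is invertible modulo p ^ N, and the natural numbers
    congruent to m / k modulo p ^ N approximate it. *)
Lemma nat_near_frac m k e : coprime k p -> 0 < e ->
  exists n : nat, v (m%:R / k%:R - n%:R : Kv) < e.
Proof.
move=> kp e0; have [|N Ne] := @expr_lt_eps _ (v (p%:R : Kv)) e _ e0.
  by rewrite vabs_ge0 vabs_p_lt1.
have k0 := coprime_prime_gt0 kp.
case: (egcdnP (p ^ N) k0) => a b abE _.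
have kpN : coprime k (p ^ N) by rewrite coprimeXr.
move: abE; rewrite (eqP kpN) => abE; exists (m * a)%N.
have kn0 := padic_natr_neq0 k0.
have -> : m%:R / k%:R - (m * a)%:R = - (m * b * p ^ N)%:R / k%:R :> Kv.
  apply: (mulIf kn0); rewrite mulrBl !mulfVK// -natrM -mulnA abE.
  by rewrite mulnDr muln1 natrD mulnA opprD addrCA subrr addr0.
rewrite vabs_mul vabs_inv vabs_coprime// invr1 mulr1 vabs_opp.
apply: le_lt_trans Ne; rewrite -vabs_exp -natrX.
by apply: vabs_dvdn; rewrite dvdn_mull.
Qed.

(** - n is congruent to n (p ^ N - 1) modulo p ^ N. *)
Lemma nat_near_opp n e : 0 < e -> exists m : nat, v (- n%:R - m%:R : Kv) < e.
Proof.
move=> e0; have [|N Ne] := @expr_lt_eps _ (v (p%:R : Kv)) e _ e0.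
  by rewrite vabs_ge0 vabs_p_lt1.
exists (n * (p ^ N).-1)%N.
rewrite -opprD vabs_opp -natrD -mulnS prednK ?expn_gt0 ?prime_gt0//.
apply: le_lt_trans Ne; rewrite -vabs_exp -natrX.
by apply: vabs_dvdn; rewrite dvdn_mull.
Qed.

Lemma nat_near_rat (s : rat) e : v (ratr s : Kv) <= 1 -> 0 < e ->
  exists n : nat, v (ratr s - n%:R : Kv) < e.
Proof.
move=> s1 e0.
have ratrE : ratr s = (numq s)%:~R / (`|denq s|%N)%:R :> Kv.
  by rewrite /ratr -[in LHS]absz_denq -pmulrn.
set k := `|denq s|%N in ratrE; set a := `|numq s|%N.
have k0 : (0 < k)%N by rewrite absz_gt0 denq_eq0.
have va : v ((numq s)%:~R : Kv) = v (a%:R : Kv).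
  rewrite /a; case: (intP (numq s)) => [|n|n]; rewrite ?abszN ?absz_nat //.
  by rewrite rmorphN/= vabs_opp.
have kp : coprime k p.
  rewrite coprime_sym prime_coprime//; apply/negP => pk.
  have pa : ~~ (p %| a)%N.
    apply/negP => pa; have := coprime_num_den s.
    rewrite /coprime -/a -/k => /eqP gcd1.
    have := dvdn_gcd p a k.
    by rewrite gcd1 pa pk dvdn1 gtn_eqF ?prime_gt1.
  have va1 : v (a%:R : Kv) = 1.
    by rewrite vabs_coprime// coprime_sym prime_coprime.
  move: s1; rewrite ratrE vabs_mul va va1 mul1r vabs_inv.
  have vk0 : 0 < v (k%:R : Kv) by rewrite vabs_gt0 padic_natr_neq0.
  rewrite leNgt invf_gt1// => /negP; apply.
  exact: le_lt_trans (vabs_dvdn pk) vabs_p_lt1.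
have [n an] := @nat_near_frac a k e kp e0.
have [num0|num0] := leP 0 (numq s).
  by exists n; rewrite ratrE -(gez0_abs num0) -pmulrn.
have [m nm] := nat_near_opp n e0; exists m.
apply: vabs_trans nm; rewrite ratrE -[numq s]opprK -(ltz0_abs num0) rmorphN/=.
by rewrite -pmulrn mulNr -opprD vabs_opp.
Qed.

(** A p-adic integer is close to a rational of absolute value at most 1, whose
    denominator is prime to p; such a fraction is close to a natural number. *)
Lemma padic_intP x :
  padic_int x <-> forall e, 0 < e -> exists n : nat, v (x - n%:R) < e.
Proof.
split=> [[xQ x1] e e0|xN].
  have m0 : 0 < Num.min e 1 by rewrite lt_min e0 ltr01.
  have [_ [[s _ <-]]] := xQ (ball x (Num.min e 1)) (nbhsx_ballx x _ m0).
  rewrite vballE/= lt_min => /andP[xse xs1].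
  have [|n sn] := @nat_near_rat s e _ e0; last by exists n; apply: vabs_trans sn.
  by rewrite -[ratr s](subKr x); apply: vabsD_le; rewrite // vabs_opp ltW.
split; last first.
  have [n xn] := xN 1 ltr01; rewrite -(subrK n%:R x).
  by apply: vabsD_le; rewrite ?vabs_nat_le1// ltW.
move=> B /nbhs_ballP[e /= e0 Be]; have [n xn] := xN e e0.
exists n%:R; split; last by apply: Be; rewrite vballE.
by exists n%:R => //; rewrite ratr_nat.
Qed.

Lemma padic_intD x y : padic_int x -> padic_int y -> padic_int (x + y).
Proof.
move=> /padic_intP xN /padic_intP yN; apply/padic_intP => e e0.
have [[n xn] [m ym]] := (xN e e0, yN e e0); exists (n + m)%N.
by rewrite natrD opprD addrACA; apply: vabsD_lt.
Qed.

Lemma padic_intMn n x : padic_int x -> padic_int (n%:R * x).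
Proof.
move=> /padic_intP xN; apply/padic_intP => e e0.
have [m xm] := xN e e0; exists (n * m)%N.
rewrite natrM -mulrBr vabs_mul; apply: le_lt_trans xm.
by rewrite ler_piMl ?vabs_ge0// vabs_nat_le1.
Qed.

Lemma padic_int_frac m k : coprime k p -> padic_int (m%:R / k%:R : Kv).
Proof. by move=> kp; apply/padic_intP => e; apply: nat_near_frac. Qed.

Lemma padic_int_nat n : padic_int (n%:R : Kv).
Proof. by apply/padic_intP => e e0; exists n; rewrite subrr vabs_zero. Qed.

End PadicIntegers.

(** * Powers with p-adic exponents *)

Section PadicPowers.
Variables (R : realType) (p : nat) (K : fieldType) (v : ultrametric_abs R K).
Hypotheses (p_prime : prime p) (vp : v p%:R = p%:R^-1).
Local Notation Kv := (valued v).
Implicit Types (x y z Q w : Kv) (e : R).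

(** In Q ^+ p - 1 = (Q - 1) * \sum_(i < p) Q ^+ i the second factor is close to
    p, so it is small; the bound stays the same from one p-th power to the
    next. *)
Lemma vabs_expp_sub1 Q (r : R) :
  v (Q - 1) <= r -> r < 1 -> v (p%:R : Kv) <= r ->
  v (Q ^+ p - 1) <= r * v (Q - 1).
Proof.
move=> Qr r1 pr; rewrite subrX1 vabs_mul mulrC.
rewrite ler_wpM2r ?vabs_ge0//.
have -> : \sum_(i < p) Q ^+ i = \sum_(i < p) (Q ^+ i - 1) + p%:R.
  by rewrite sumrB sumr_const card_ord subrK.
apply: vabsD_le => //; apply: vabs_sum_le => [|i _].
  exact: le_trans (vabs_ge0 _ _) Qr.
apply: (le_trans _ Qr); apply: vabs_exp_sub1; exact: le_lt_trans Qr r1.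
Qed.

Lemma exp_pfactor_near1 Q e : v (Q - 1) < 1 -> 0 < e ->
  exists N, v (Q ^+ (p ^ N) - 1) < e.
Proof.
move=> Q1 e0; pose r := Num.max (v (Q - 1)) (v (p%:R : Kv)).
have r1 : r < 1 by rewrite gt_max Q1 (vabs_p_lt1 p_prime vp).
have Qr : v (Q - 1) <= r by rewrite le_max lexx.
have r0 : 0 <= r := le_trans (vabs_ge0 _ _) Qr.
have QN N : v (Q ^+ (p ^ N) - 1) <= r ^+ N.
  elim: N => [|N IH]; first by rewrite expn0 expr1 expr0 ltW.
  rewrite expnSr exprM exprS.
  apply: (@le_trans _ _ (r * v (Q ^+ (p ^ N) - 1))); last by rewrite ler_wpM2l.
  apply: vabs_expp_sub1 => //; last by rewrite le_max lexx orbT.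
  by apply: le_trans (Qr); apply: vabs_exp_sub1.
have [|N Ne] := @expr_lt_eps _ r e _ e0; first by rewrite r0 r1.
by exists N; apply: le_lt_trans Ne.
Qed.

Lemma exp_pfactor_cvg1 Q e : v (Q - 1) < 1 -> 0 < e ->
  \forall N \near \oo, forall m, v (Q ^+ (p ^ N * m) - 1) < e.
Proof.
move=> Q1 e0; have [M Me] := exp_pfactor_near1 Q1 e0.
exists M => // N /= MN m; apply: le_lt_trans Me.
rewrite -(subnKC MN) expnD -mulnA exprM.
by apply: vabs_exp_sub1; apply: vabs_exp_near1.
Qed.

(** If m and n are congruent modulo p ^ N, then Q ^+ m - Q ^+ n is a multiple
    of Q ^+ (p ^ N * k) - 1, which is small. *)
Lemma exp_unif_continuous Q e : v (Q - 1) < 1 -> 0 < e ->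
  exists2 d : R, 0 < d & forall m n : nat,
    v (m%:R - n%:R : Kv) < d -> v (Q ^+ m - Q ^+ n) < e.
Proof.
move=> Q1 e0; have [N _ /(_ N (leqnn N)) Ne] := exp_pfactor_cvg1 Q1 e0.
exists (v (p%:R : Kv) ^+ N); first by rewrite exprn_gt0// (vabs_p_gt0 p_prime vp).
move=> m n; wlog nm : m n / (n <= m)%N => [hw mn|].
  case: (leqP n m) => [|/ltnW] /hw; first exact.
  by rewrite vabs_sub [X in X < e]vabs_sub; exact.
rewrite -natrB// => /ltW /(vabs_dvdn_pfactor p_prime vp)/dvdnP[k kE].
rewrite -{1}(subnK nm) exprD -[X in _ - X]mul1r -mulrBl vabs_mul.
by rewrite (vabs_unit_exp n Q1) mulr1 kE mulnC.
Qed.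

(** The power Q ^ x as a limit over natural exponents, stated as a relation so
    that the laws of exponents follow from those for natural exponents, whatever
    the construction of Q ^ x. *)
Definition is_padic_power Q x w := forall e, 0 < e ->
  exists2 d : R, 0 < d & forall m : nat, v (x - m%:R) < d -> v (w - Q ^+ m) < e.

Lemma is_padic_power_unique Q x w1 w2 : padic_int x ->
  is_padic_power Q x w1 -> is_padic_power Q x w2 -> w1 = w2.
Proof.
move=> /(padic_intP p_prime vp) xN w1P w2P; apply/eqP; rewrite -subr_eq0.
apply/negPn/negP; rewrite -vabs_gt0 => e0.
have [[d1 d10 H1] [d2 d20 H2]] := (w1P _ e0, w2P _ e0).
have [|m] := xN (Num.min d1 d2); first by rewrite lt_min d10.
rewrite lt_min => /andP[/H1 w1m /H2 w2m]; move: w2m; rewrite vabs_sub => w2m.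
by have := vabs_trans w1m w2m; rewrite ltxx.
Qed.

(** By uniform continuity, a cluster point of Q ^+ m when m tends to x is a
    limit. *)
Lemma is_padic_power_cluster Q x w : v (Q - 1) < 1 ->
  (forall d e, 0 < d -> 0 < e ->
    exists2 m : nat, v (x - m%:R) < d & v (w - Q ^+ m) < e) ->
  is_padic_power Q x w.
Proof.
move=> Q1 wcl e e0; have [d d0 h] := exp_unif_continuous Q1 e0.
exists d => // m xm; have [n xn wn] := wcl d e d0 e0.
apply: vabs_trans wn _; apply: h; apply: vabs_trans xm.
by rewrite vabs_sub.
Qed.

Lemma is_padic_power_nat Q m : v (Q - 1) < 1 -> is_padic_power Q m%:R (Q ^+ m).
Proof.
move=> Q1; apply: is_padic_power_cluster => // d e d0 e0.
by exists m; rewrite subrr vabs_zero.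
Qed.

Lemma is_padic_powerD Q x w n : v (Q - 1) < 1 -> padic_int x ->
  is_padic_power Q x w -> is_padic_power Q (x + n%:R) (w * Q ^+ n).
Proof.
move=> Q1 /(padic_intP p_prime vp) xN wP.
apply: is_padic_power_cluster => // d e d0 e0.
have [d' d'0 h] := wP e e0.
have [|m] := xN (Num.min d d'); first by rewrite lt_min d0.
rewrite lt_min => /andP[xm /h wm]; exists (m + n)%N.
  by rewrite natrD opprD addrACA subrr addr0.
by rewrite exprD -mulrBl vabs_mul (vabs_unit_exp n Q1) mulr1.
Qed.

Lemma is_padic_powerMn Q x w n : v (Q - 1) < 1 -> padic_int x ->
  is_padic_power (Q ^+ n) x w -> is_padic_power Q (n%:R * x) w.
Proof.
move=> Q1 /(padic_intP p_prime vp) xN wP.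
apply: is_padic_power_cluster => // d e d0 e0.
have [d' d'0 h] := wP e e0.
have [|m] := xN (Num.min d d'); first by rewrite lt_min d0.
rewrite lt_min => /andP[xm /h wm]; exists (n * m)%N; last by rewrite exprM.
rewrite natrM -mulrBr vabs_mul; apply: le_lt_trans xm.
by rewrite ler_piMl ?vabs_ge0// vabs_nat_le1.
Qed.

Hypothesis complete_v :
  forall F : set_system Kv, ProperFilter F -> cauchy F -> cvg F.

(** The filter generated by the Q ^+ m for m close to x is Cauchy by uniform
    continuity. *)
Lemma is_padic_power_exists Q x : v (Q - 1) < 1 -> padic_int x ->
  exists w, is_padic_power Q x w.
Proof.
move=> Q1 /(padic_intP p_prime vp) xN.
pose F := [set A : set Kv | exists2 d : R, 0 < d &
  forall m : nat, v (x - m%:R) < d -> A (Q ^+ m)].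
have FF : Filter F.
  split; first by exists 1.
  - move=> A B [a a0 aA] [b b0 bB]; exists (Num.min a b) => [|m].
      by rewrite lt_min a0.
    by rewrite lt_min => /andP[/aA ? /bB].
  - by move=> A B AB [a a0 aA]; exists a => // m /aA /AB.
have FP : ProperFilter F.
  apply: Build_ProperFilter_ex => A [a a0 aA].
  by have [m /aA] := xN a a0; exists (Q ^+ m).
have /complete_v : cauchy F.
  apply/cauchy_exP => e e0.
  have [d d0 h] := exp_unif_continuous Q1 e0.
  have [n xn] := xN d d0; exists (Q ^+ n), d => // m xm.
  rewrite vballE /=; apply: h; apply: vabs_trans xm.
  by rewrite vabs_sub.
move=> Fw; exists (lim F) => e e0.
by have [d d0 h] := Fw _ (nbhsx_ballx (lim F) e e0); exists d.
Qed.

(** Choosing a limit of Q ^+ m at every p-adic integer gives a continuous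
    function, so that the choice made by [padic_exp] is not a default value;
    and continuity at x forces the value there. *)
Lemma padic_expP Q x : v (Q - 1) < 1 -> padic_int x ->
  is_padic_power Q x (padic_exp Q x).
Proof.
move=> Q1 xint.
have [f fP] : exists f : Kv -> Kv,
    forall y, padic_int y -> is_padic_power Q y (f y).
  have /choice[f fP] : forall y, exists w, padic_int y -> is_padic_power Q y w.
    move=> y; have [yint|yint] := pselect (padic_int y); last by exists 0.
    by have [w wP] := is_padic_power_exists Q1 yint; exists w.
  by exists f.
have [fc fn] : {within @padic_int _ _ v, continuous f} /\
    forall m : nat, f m%:R = Q ^+ m.
  split=> [|m]; last first.
    apply: (is_padic_power_unique (padic_int_nat p_prime vp m)).
      exact: fP (padic_int_nat p_prime vp m).
    exact: is_padic_power_nat.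
  apply/subspace_continuousP => y yint; apply/cvg_vabsP => e e0.
  have [d d0 h] := fP y yint e e0.
  rewrite near_withinE; near=> z => zint.
  have [d' d'0 h'] := fP z zint e e0.
  have [|m] := (padic_intP p_prime vp z).1 zint (Num.min d d').
    by rewrite lt_min d0.
  rewrite lt_min => /andP[zm /h' fzm].
  have /h fym : v (y - m%:R) < d.
    apply: vabs_trans zm; near: z.
    by apply/nbhs_ballP; exists d => //= z; rewrite vballE.
  by apply: (vabs_trans fym); rewrite vabs_sub.
have [gc gn] : [set g : Kv -> Kv | {within @padic_int _ _ v, continuous g} /\
    forall m : nat, g m%:R = Q ^+ m] (padic_exp Q).
  by apply: xgetPex; exists f.
apply: is_padic_power_cluster => // d e d0 e0.
move/subspace_continuousP/(_ x xint)/cvg_vabsP/(_ e e0): gc.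
rewrite near_withinE => /nbhs_ballP[d' /= d'0 h].
have [|m] := (padic_intP p_prime vp x).1 xint (Num.min d d').
  by rewrite lt_min d0.
rewrite lt_min => /andP[xm xm']; exists m => //.
rewrite -gn; apply: h; first by rewrite vballE.
exact: (padic_int_nat p_prime vp).
Unshelve. all: by end_near. Qed.

Lemma padic_expD Q x n : v (Q - 1) < 1 -> padic_int x ->
  padic_exp Q (x + n%:R) = padic_exp Q x * Q ^+ n.
Proof.
move=> Q1 xint.
have xnint := padic_intD p_prime vp xint (padic_int_nat p_prime vp n).
apply: (is_padic_power_unique xnint (padic_expP Q1 xnint)).
by apply: is_padic_powerD => //; apply: padic_expP.
Qed.

Lemma padic_expMn Q x n : v (Q - 1) < 1 -> padic_int x ->
  padic_exp Q (n%:R * x) = padic_exp (Q ^+ n) x.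
Proof.
move=> Q1 xint; have nxint := padic_intMn p_prime vp n xint.
apply: (is_padic_power_unique nxint (padic_expP Q1 nxint)).
by apply: is_padic_powerMn => //; apply: padic_expP => //; apply: vabs_exp_near1.
Qed.

End PadicPowers.

(** * Convergence of the fermionic averages *)

Section EulerPolynomials.
Variables (R : realType) (p : nat) (K : fieldType) (v : ultrametric_abs R K).
Hypotheses (p_prime : prime p) (vp : v p%:R = p%:R^-1) (p_odd : odd p).
Hypothesis complete_v :
  forall F : set_system (valued v), ProperFilter F -> cauchy F -> cvg F.
Local Notation Kv := (valued v).
Implicit Types (x y z Q w : Kv) (e : R).

Lemma expNr_odd Q m : odd m -> (- Q) ^+ m = - Q ^+ m.
Proof. by move=> mo; rewrite exprNn -signr_odd mo mulN1r. Qed.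

(** 1 + Q ^+ m is close to 2, and 2 is a unit because p is odd. *)
Lemma vabs_1Dexp Q m : v (Q - 1) < 1 -> v (1 + Q ^+ m) = 1.
Proof.
move=> Q1; have v2 : v (2%:R : Kv) = 1.
  by apply: (vabs_coprime p_prime vp); rewrite coprime2n.
rewrite -v2; apply: vabs_eq_near; rewrite v2.
by rewrite -[2%:R]/(1 + 1) opprD addrACA subrr add0r; apply: vabs_exp_near1.
Qed.

Lemma neq0_1Dexp Q m : v (Q - 1) < 1 -> 1 + Q ^+ m != 0.
Proof. by move=> Q1; rewrite -vabs_gt0 vabs_1Dexp. Qed.

Lemma qnumN_odd Q m : odd m -> qnum m (- Q) = (1 + Q ^+ m) / (1 + Q).
Proof.
by move=> mo; rewrite /qnum expNr_odd// -!opprD invrN mulrNN addrC [Q + 1]addrC.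
Qed.

Lemma geometric_sum (z : Kv) m : z - 1 != 0 ->
  \sum_(0 <= y < m) z ^+ y = (z ^+ m - 1) / (z - 1).
Proof.
by move=> z1; rewrite big_mkord subrX1 mulrAC mulfV// mul1r.
Qed.

(** Both the sum and its normalizing factor are geometric sums, of the form
    (1 + Q ^ (m p ^ N)) / (1 + Q ^ m) with m = j + 1 and m = 1; their numerators
    have the same limit 2, which is not 0. *)
Lemma fermionic_exp_cvg Q j : v (Q - 1) < 1 ->
  (qnum (p ^ N) (- Q))^-1 * \sum_(0 <= y < p ^ N) (- Q) ^+ y * (Q ^+ j) ^+ y
    @[N --> \oo] --> (1 + Q) / (1 + Q ^+ j.+1).
Proof.
move=> Q1; have pNo N : odd (p ^ N) by rewrite oddX p_odd orbT.
have Qj0 := neq0_1Dexp j.+1 Q1; have QN0 N := neq0_1Dexp (p ^ N) Q1.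
have Q0 : 1 + Q != 0 by have := neq0_1Dexp 1 Q1; rewrite expr1.
pose B N := (1 + Q ^+ (j.+1 * p ^ N)) / (1 + Q ^+ (p ^ N)).
have uE N : (qnum (p ^ N) (- Q))^-1 *
    \sum_(0 <= y < p ^ N) (- Q) ^+ y * (Q ^+ j) ^+ y =
    (1 + Q) / (1 + Q ^+ j.+1) * B N.
  rewrite qnumN_odd//.
  under eq_bigr do rewrite -exprMn mulNr -exprS.
  rewrite geometric_sum; last by rewrite -opprD oppr_eq0 addrC.
  rewrite expNr_odd// -!opprD invrN mulrNN -exprM ![_ + 1]addrC invf_div.
  by rewrite mulrACA [RHS]mulrACA; congr (_ * _); rewrite mulrC.
under eq_cvg do rewrite uE.
apply/cvg_vabsP => e e0.
have := exp_pfactor_cvg1 p_prime vp Q1 e0; apply: filterS => N QNe.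
rewrite -[X in X - _]mulr1 -mulrBr vabs_mul.
have -> : v ((1 + Q) / (1 + Q ^+ j.+1)) = 1.
  by rewrite vabs_mul vabs_inv -[Q in 1 + Q]expr1 !vabs_1Dexp// invr1 mulr1.
have -> : 1 - B N = (Q ^+ (p ^ N) - Q ^+ (j.+1 * p ^ N)) / (1 + Q ^+ (p ^ N)).
  apply: (mulIf (QN0 N)); rewrite mulrBl /B !mulfVK// mul1r.
  by rewrite opprD addrACA subrr add0r.
rewrite mul1r vabs_mul vabs_inv vabs_1Dexp// invr1 mulr1 -(subrKA 1).
apply: vabsD_lt; first by have := QNe 1%N; rewrite muln1.
by rewrite vabs_sub mulnC.
Qed.

(** Expand the n-th power of [x + y : Q ^ alpha] by the binomial formula: it is
    a combination of the powers (Q ^ (alpha k)) ^ y, each of which averages to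
    a limit. *)
Lemma euler_poly_cvg alpha n Q x : v (Q - 1) < 1 -> padic_int x ->
  exists l : Kv,
  (qnum (p ^ N) (- Q))^-1 * \sum_(0 <= y < p ^ N)
    (- Q) ^+ y * padic_qnum (x + y%:R) (Q ^+ alpha) ^+ n
  @[N --> \oo] --> l.
Proof.
have ringE (V : comNzRingType) (a b c g h : V) :
    a * (b * c) * g * h = g * (a * b) * (h * c) by ring.
move=> Q1 xint; set P := Q ^+ alpha.
have P1 : v (P - 1) < 1 by apply: vabs_exp_near1.
pose c (k : 'I_n.+1) : Kv := (P - 1)^-1 ^+ n *
  ((-1) ^+ k * padic_exp P x ^+ (n - k)) *+ 'C(n, k).
pose u (k : 'I_n.+1) N := (qnum (p ^ N) (- Q))^-1 *
  \sum_(0 <= y < p ^ N) (- Q) ^+ y * (Q ^+ (alpha * (n - k))) ^+ y.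
pose l (k : 'I_n.+1) := (1 + Q) / (1 + Q ^+ (alpha * (n - k)).+1).
have uE N : (qnum (p ^ N) (- Q))^-1 * \sum_(0 <= y < p ^ N)
    (- Q) ^+ y * padic_qnum (x + y%:R) P ^+ n = \sum_k c k * u k N.
  under [RHS]eq_bigr do rewrite /u mulrCA.
  rewrite -mulr_sumr; congr (_ * _).
  under [RHS]eq_bigr do rewrite mulr_sumr.
  rewrite exchange_big/=; apply: eq_bigr => y _.
  rewrite /padic_qnum (padic_expD p_prime vp complete_v)//.
  rewrite exprMn exprBn mulrC !mulr_suml.
  apply: eq_bigr => k _.
  rewrite /c expr1n mulr1 exprMn -!exprM.
  by rewrite [(y * _)%N]mulnC mulnA !mulrnAl ringE.
exists (\sum_k c k * l k).
under eq_cvg do rewrite uE.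
by apply: cvg_vabs_sum => k; apply: fermionic_exp_cvg.
Qed.

Lemma sum_euclid (F : nat -> Kv) d m :
  \sum_(0 <= y < d * m) F y =
  \sum_(0 <= a < d) \sum_(0 <= z < m) F (a + d * z)%N.
Proof.
elim: m => [|m IH].
  by rewrite muln0 big_geq// big1// => a _; rewrite big_geq.
rewrite mulnS addnC (big_cat_nat (n := (d * m)%N)) ?leq_addr//= IH.
under [RHS]eq_bigr do rewrite big_nat_recr//=.
rewrite big_split/=; congr (_ + _).
by rewrite -{1}[(d * m)%N]add0n big_addn addKn.
Qed.

Lemma qnum_mul d m Q : Q ^+ d - 1 != 0 ->
  qnum (d * m) Q = qnum d Q * qnum m (Q ^+ d).
Proof.
by move=> Qd; rewrite /qnum exprM [RHS]mulrC mulrA mulfVK. Qed.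

Lemma padic_qnumM d y Q : v (Q - 1) < 1 -> Q ^+ d - 1 != 0 -> padic_int y ->
  padic_qnum (d%:R * y) Q = qnum d Q * padic_qnum y (Q ^+ d).
Proof.
move=> Q1 Qd yint; rewrite /padic_qnum /qnum (padic_expMn p_prime vp complete_v)//.
by rewrite [RHS]mulrC mulrA mulfVK.
Qed.

End EulerPolynomials.

(** * Distribution relation *)

Section Distribution.
Variables (R : realType) (p : nat) (K : fieldType) (v : ultrametric_abs R K).
Hypotheses (p_prime : prime p) (vp : v p%:R = p%:R^-1) (p_odd : odd p).
Hypothesis complete_v :
  forall F : set_system (valued v), ProperFilter F -> cauchy F -> cvg F.
Local Notation Kv := (valued v).

(** Write y < d m as a + d z with a < d and z < m, and use
    d x + y = d (x + a / d + z). *)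
Lemma dirichlet_euler_sum_distribution (d : nat) (chi : int -> Kv)
    (alpha n m : nat) (q x : Kv) :
  (forall a z : nat, chi (a + d * z)%N = chi a) ->
  odd d -> coprime d p -> v (q - 1) < 1 -> (q ^+ alpha) ^+ d - 1 != 0 ->
  padic_int x ->
  (qnum (d * m) (- q))^-1 * \sum_(0 <= y < d * m)
     (- q) ^+ y * chi y%:Z * padic_qnum (d%:R * x + y%:R) (q ^+ alpha) ^+ n =
  \sum_(0 <= a < d) qnum d (q ^+ alpha) ^+ n / qnum d (- q) *
    ((-1) ^+ a * chi a%:Z * q ^+ a) *
    ((qnum m (- q ^+ d))^-1 * \sum_(0 <= z < m)
       (- q ^+ d) ^+ z *
       padic_qnum (x + a%:R / d%:R + z%:R) ((q ^+ d) ^+ alpha) ^+ n).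
Proof.
have ringE (V : comNzRingType) (A C c s t g z w : V) :
    A * C * (s * t * z * c * (g * w)) = g * A * (s * c * t) * (C * (z * w)).
  by ring.
move=> chiE d_odd dp q1 qad xint.
have d0 : d%:R != 0 :> Kv.
  exact: (padic_natr_neq0 p_prime vp (coprime_prime_gt0 p_prime dp)).
rewrite qnum_mul; last first.
  by rewrite expNr_odd// -opprD oppr_eq0 addrC (neq0_1Dexp p_prime vp p_odd).
rewrite expNr_odd// invfM sum_euclid mulr_sumr.
apply: eq_bigr => a _; rewrite !mulr_sumr; apply: eq_bigr => z _.
have -> : d%:R * x + (a + d * z)%:R = d%:R * (x + a%:R / d%:R + z%:R).
  by rewrite !mulrDr natrD natrM mulrCA divff// mulr1 addrA.
rewrite (padic_qnumM p_prime vp complete_v)//; first last.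
- apply: (padic_intD p_prime vp); last exact: (padic_int_nat p_prime vp).
  by apply: (padic_intD p_prime vp) => //; apply: (padic_int_frac p_prime vp).
- exact: vabs_exp_near1.
rewrite chiE exprAC exprMn exprD exprM (expNr_odd q d_odd) [(- q) ^+ a]exprNn.
by rewrite ringE.
Qed.

End Distribution.

Theorem theorem4 (R : realType) (p : nat) (K : fieldType)
    (v : ultrametric_abs R K)
    (p_prime : prime p) (p_odd : odd p) (hCp : is_Cp p v)
    (q : valued v) (hq : v (q - 1) < 1)
    (q_not_root1 : forall m : nat, (0 < m)%N -> ~~ m.-unity_root q)
    (alpha : nat) (alpha_gt0 : (0 < alpha)%N)
    (iota : {rmorphism algC -> valued v})
    (d : nat) (chi : int -> algC)
    (hchi : dirichlet_character_of_conductor d chi)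
    (d_odd : odd d) (d_p : coprime d p)
    (n : nat) (x : valued v) (hx : padic_int x) :
  dirichlet_euler_poly p d (iota \o chi) alpha n q (d%:R * x) =
  qnum d (q ^+ alpha) ^+ n / qnum d (- q) *
  \sum_(0 <= a < d)
    (-1) ^+ a * iota (chi a%:Z) * q ^+ a *
    euler_poly p alpha n (q ^+ d) (x + a%:R / d%:R).
Proof.
have vp := Cp_vabsp hCp; have complete_v := Cp_complete hCp.
have [d_gt0 [chi_periodic _ _ _] _] := hchi.
have chiE (a z : nat) : (iota \o chi) (a + d * z)%N = (iota \o chi) a.
  congr (iota _); apply: chi_periodic; rewrite PoszD PoszM.
  by rewrite addrC mulrC modzMDl.
have qad : (q ^+ alpha) ^+ d - 1 != 0.
  rewrite -exprM; have := q_not_root1 (alpha * d)%N.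
  by rewrite muln_gt0 alpha_gt0 d_gt0 /root_of_unity /root !hornerE subr_eq0; exact.
have qd1 := vabs_exp_near1 d hq.
rewrite mulr_sumr; under [RHS]eq_bigr do rewrite mulrA.
apply: cvg_vabs_lim; under eq_cvg do
  rewrite (dirichlet_euler_sum_distribution p_prime vp p_odd complete_v)//.
apply: cvg_vabs_sum => a.
have xa : padic_int (x + a%:R / d%:R).
  by apply: (padic_intD p_prime vp) => //; apply: (padic_int_frac p_prime vp).
have [l ul] := euler_poly_cvg p_prime vp p_odd complete_v alpha n qd1 xa.
by rewrite /euler_poly (cvg_vabs_lim ul).
Qed.
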